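(* Let $X\subset\mathbb{R}^n$ be a compact set, let $f:X\to\mathbb{R}$ be continuous, let $V$ be the linear span of finitely many linearly independent real polynomials in $n$ variables, and let $Q=\operatorname{Arg\,min}_{q\in V}\|f-q\|_\infty$, where $\|f-q\|_\infty=\max_{x\in X}|f(x)-q(x)|$. Then $\dim Q\le\dim S$; moreover, for any $q,p\in Q$ we have $p-q\in S(p)\subseteq S$.
   Context: For $q\in V$ put $$\mathcal{N}(q)=\{x\in X\mid q(x)-f(x)=\|f-q\|_\infty\},\qquad \mathcal{P}(q)=\{x\in X\mid f(x)-q(x)=\|f-q\|_\infty\}.$$ For $q\in V$, the set of all polynomials in $V$ that separate the points of minimal and maximal deviation is $$S(q)=\{s\in V\mid s(x)\cdot s(y)\le 0\ \ \forall x\in\mathcal{P}(q),\ y\in\mathcal{N}(q)\}.$$ The set $Q$ is nonempty, closed and convex (as a subset of the finite-dimensional space $V$, whose elements are polynomials, not restrictions to $X$). For $q$ in the relative interior $\operatorname{ri}Q$ (taken with respect to the coefficients of the polynomials), the sets $\mathcal{N}(q),\mathcal{P}(q)$ do not depend on $q$; $S$ denotes the common value $S=S(q)$, $q\in\operatorname{ri}Q$. The dimension of a subset of $V$ is the dimension of its affine hull (for $S$, which contains $0$, this is the dimension of its linear span, i.e. the maximal number of linearly independent elements of $S$). *)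

(* Defs.v *)
(* MathComp / MathComp-Analysis, with multinomials' multivariate polynomials. *)
From mathcomp Require Import all_boot all_order all_algebra.
(* The notations of mpoly clash with those of MathComp-Analysis:
   [mpoly n R] is the ring usually written {mpoly R[n]}, [meval v q] is q.@[v]
   and [mcoeff m q] is the coefficient q@_m. *)
From mathcomp Require Import -(notations) mpoly.
From mathcomp Require Import all_classical all_reals all_analysis.

Set Implicit Arguments.
Unset Strict Implicit.
Unset Printing Implicit Defensive.

Import Order.TTheory GRing.Theory Num.Theory numFieldNormedType.Exports.

Local Open Scope classical_set_scope.
Local Open Scope ring_scope.

Section Dimension.
Context {R : fieldType} {E : lmodType R}.

Definition lin_indep {k : nat} (b : 'I_k -> E) : Prop :=
  forall c : 'I_k -> R, \sum_(i < k) c i *: b i = 0 -> forall i, c i = 0.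

Definition lin_span {k : nat} (b : 'I_k -> E) : set E :=
  [set v | exists c : 'I_k -> R, v = \sum_(i < k) c i *: b i].

Definition aff_hull (A : set E) : set E :=
  [set v | exists (k : nat) (c : 'I_k -> R) (a : 'I_k -> E),
    [/\ forall i, A (a i), \sum_(i < k) c i = 1 &
        v = \sum_(i < k) c i *: a i]].

(* The linear subspace parallel to the affine hull. *)
Definition aff_direction (A : set E) : set E :=
  [set w | exists u v, [/\ aff_hull A u, aff_hull A v & w = u - v]].

(* The maximal number of linearly independent elements of the linear subspace
   parallel to the affine hull of A. It takes the junk value 0 when these
   numbers are unbounded, which never happens for a subset of the span of
   finitely many vectors. *)
Definition aff_dim (A : set E) : nat :=
  supremum 0%N [set k : nat | exists b : 'I_k -> E,
    lin_indep b /\ forall i, aff_direction A (b i)].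

End Dimension.

Section Approximation.
Context {R : realType} {n : nat}.
Implicit Types (X : set 'rV[R]_n) (f : 'rV[R]_n -> R) (V : set (mpoly n R)).

Definition peval (q : mpoly n R) (x : 'rV[R]_n) : R := meval (x ord0) q.

(* Relative interior of a set of polynomials, for the topology given by the
   coefficients: on a finite-dimensional space of polynomials, the sets
   [set q | forall m, `|mcoeff m q - mcoeff m p| < e] are the open balls of the
   norm "largest absolute value of a coefficient". *)
Definition ri (A : set (mpoly n R)) : set (mpoly n R) :=
  [set p | aff_hull A p /\ exists2 e : R, 0 < e &
    forall q, aff_hull A q ->
      (forall m, `|mcoeff m q - mcoeff m p| < e) -> A q].

(* The uniform norm ||f - q|| over X; the supremum is a maximum when X is
   nonempty and compact and f is continuous on X, and it is 0 when X is empty. *)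
Definition deviation X f (q : mpoly n R) : R :=
  sup [set `|f x - peval q x| | x in X].

Definition argmin_dev X f V : set (mpoly n R) :=
  [set q | V q /\ forall p, V p -> deviation X f q <= deviation X f p].

Definition Nset X f (q : mpoly n R) : set 'rV[R]_n :=
  [set x | X x /\ peval q x - f x = deviation X f q].

Definition Pset X f (q : mpoly n R) : set 'rV[R]_n :=
  [set x | X x /\ f x - peval q x = deviation X f q].

Definition Sset X f V (q : mpoly n R) : set (mpoly n R) :=
  [set s | V s /\ forall x y, Pset X f q x -> Nset X f q y ->
    peval s x * peval s y <= 0].

End Approximation.

(* Main.v *)
Require Import Defs.
From mathcomp Require Import all_boot all_order all_algebra.
From mathcomp Require Import -(notations) mpoly.
From mathcomp Require Import all_classical all_reals all_analysis.
From mathcomp Require Import lra.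
Import Order.TTheory GRing.Theory Num.Theory numFieldNormedType.Exports.
Local Open Scope classical_set_scope.
Local Open Scope ring_scope.

(** Let [p], [q] be best approximations, with the common error [d]. Where
    [f - p] equals [d], [p - q] is [(f - q) - (f - p) <= d - d], and where
    [p - f] equals [d], [p - q >= 0] likewise; so [p - q] separates the extremal
    points of [p] ([argmin_sub_Sset]).

    Take now [q0] in the relative interior of [Q]. The segment from any [p] in
    [Q] to [q0] can be prolonged a little beyond [q0] inside [Q]
    ([ri_prolong]), so [q0] is a proper convex combination of [p] and of another
    best approximation [r]. A weighted mean of two errors, both at most [d],
    equals [d] only if both do: an extremal point of [q0] is therefore an
    extremal point of [p], of the same sign. Hence [S(p)] is contained in
    [S(q0)] ([Sset_sub_ri]).

    For the dimensions, the first part puts [q0 - Q] inside [S]. Point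
    reflection at [q0] does not change the directions of differences, so the
    linear space parallel to the affine hull of [Q] is contained in that of [S]
    ([aff_direction_reflect]). All of this takes place in the span of the
    finitely many [g i], where linearly independent families have bounded length
    ([lin_indep_leq]); this makes the dimension monotone
    ([aff_dim_le]). *)

(** * Dimension of sets of vectors *)

Section Dimension.
Context {R : fieldType} {E : lmodType R}.

Lemma lin_spanB {k : nat} (g : 'I_k -> E) (u v : E) :
  lin_span g u -> lin_span g v -> lin_span g (u - v).
Proof.
move=> [c ->] [d ->]; exists (fun i => c i - d i).
by rewrite -sumrB; apply: eq_bigr => i _; rewrite scalerBl.
Qed.

Lemma lin_span_comb {k l : nat} (g : 'I_k -> E) (c : 'I_l -> R) (a : 'I_l -> E) :
  (forall i, lin_span g (a i)) -> lin_span g (\sum_(i < l) c i *: a i).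
Proof.
move=> ga; have [d dE] := choice ga.
exists (fun j => \sum_(i < l) c i * d i j).
under eq_bigr => i _ do rewrite dE scaler_sumr.
rewrite exchange_big; apply: eq_bigr => j _.
by rewrite scaler_suml; apply: eq_bigr => i _; rewrite scalerA.
Qed.

(** If [j > k], the [j * k] matrix of coordinates has a nonzero vector in its
    row kernel, which is a linear relation between the [b i]. *)
Lemma lin_indep_leq {j k : nat} (b : 'I_j -> E) (g : 'I_k -> E) :
  lin_indep b -> (forall i, lin_span g (b i)) -> (j <= k)%N.
Proof.
move=> b_free gb; have [d dE] := choice gb.
pose M := \matrix_(i < j, l < k) d i l.
suff /eqP <- : row_free M by exact: rank_leq_col.
rewrite -kermx_eq0; apply/negPn/negP => /rowV0Pn [u /sub_kermxP uM].
move/eqP; apply; apply/rowP => i; rewrite mxE.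
apply: (b_free (fun i => u ord0 i)) => {i}.
under eq_bigr => i _ do rewrite dE scaler_sumr.
rewrite exchange_big big1// => l _.
under eq_bigr => i _ do rewrite scalerA.
have uMl : \sum_(i < j) u ord0 i * d i l = 0.
  have /rowP/(_ l) := uM; rewrite !mxE; apply: etrans.
  by apply: eq_bigr => i _; rewrite mxE.
by rewrite -scaler_suml uMl scale0r.
Qed.

Lemma aff_hull_line (A : set E) (u v : E) (t : R) :
  A u -> A v -> aff_hull A (u + t *: (u - v)).
Proof.
move=> Au Av.
exists 2%N, (fun i => if i == ord0 then 1 + t else - t),
  (fun i => if i == ord0 then u else v); split.
- by move=> i; case: ifP.
- by rewrite !big_ord_recl big_ord0 /= addr0 addrK.
- rewrite !big_ord_recl big_ord0 /= addr0 scalerDl scale1r scalerBr scaleNr.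
  by rewrite addrA.
Qed.

(** The reflection [u |-> w - u] is affine, so it carries affine hulls to affine
    hulls, and it only exchanges the two ends of a difference. *)
Lemma aff_direction_reflect (A B : set E) (w : E) :
  (forall u, A u -> B (w - u)) -> aff_direction A `<=` aff_direction B.
Proof.
move=> AB.
have hullAB u : aff_hull A u -> aff_hull B (w - u).
  move=> [k [c [a [Aa c1 ->]]]]; exists k, c, (fun i => w - a i).
  split=> // [i|]; first exact: AB.
  under [in RHS]eq_bigr => i _ do rewrite scalerBr.
  by rewrite sumrB -scaler_suml c1 scale1r.
move=> _ [u [v [Au Av ->]]]; exists (w - v), (w - u); split; [exact: hullAB..|].
by rewrite opprB [RHS]addrC addrA subrK.
Qed.

(** The span of finitely many vectors around [B] rules out the junk value of
    [aff_dim]: every length of a free family in the direction of [B] is then at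
    most its dimension. *)
Lemma aff_dim_le {k : nat} (g : 'I_k -> E) (A B : set E) :
  B `<=` lin_span g -> aff_direction A `<=` aff_direction B ->
  (aff_dim A <= aff_dim B)%N.
Proof.
move=> Bg AB.
have dirBg : aff_direction B `<=` lin_span g.
  move=> _ [_ [_ [[i [c [a [Ba _ ->]]]] [j [d [b [Bb _ ->]]]] ->]]].
  by apply: lin_spanB; apply: lin_span_comb => l; apply: Bg.
rewrite /aff_dim; set NA := [set l | _]; set NB := [set l | _].
have NAB : NA `<=` NB.
  by move=> l [b [b_free Ab]]; exists b; split=> // i; apply: AB.
have NB_bounded : ubound NB !=set0.
  by exists k => l [b [b_free Bb]]; apply: lin_indep_leq b_free _ => i; apply: dirBg.
rewrite {1}/supremum; case: ifP => // NA0.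
have : supremums NA !=set0.
  by apply: nat_supremums_neq0; case: NB_bounded => m NBm; exists m => l /NAB /NBm.
move=> /(xgetPex 0%N) [_]; apply => l /NAB.
exact: ge_supremum_Nmem (nat_supremums_neq0 NB_bounded).
Qed.

End Dimension.

(** * Best uniform approximation *)

Section Approximation.
Context {R : realType} {n : nat}.
Implicit Types (X : set 'rV[R]_n) (f : 'rV[R]_n -> R) (V A : set (mpoly n R)).
Implicit Types (p q r : mpoly n R).

Lemma peval_continuous q : continuous (peval q).
Proof.
have -> : peval q = fun x : 'rV[R]_n =>
    \sum_(m <- msupp q) mcoeff m q * \prod_(i < n) x ord0 i ^+ m i.
  by apply/funext => x; rewrite /peval mevalE.
apply: continuous_big => [|m _]; first exact: add_continuous.
move=> x; apply: continuousM; first exact: cst_continuous.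
apply: continuous_big => [|i _ y]; first exact: mul_continuous.
apply: (@continuous_comp _ _ _ (fun z : 'rV[R]_n => z ord0 i)
  (@GRing.exp R ^~ (m i))).
  exact: coord_continuous.
exact: exprn_continuous.
Qed.

Lemma le_deviation X f q x : compact X -> {within X, continuous f} -> X x ->
  `|f x - peval q x| <= deviation X f q.
Proof.
move=> cX cf Xx.
have cfq : {within X, continuous (fun y => f y - peval q y)}.
  move=> y; apply: cvgB; first exact: cf.
  exact: (continuous_subspaceT (@peval_continuous q)).
have [M [_ MP]] := compact_bounded (continuous_compact cfq cX).
apply: ub_le_sup; last by exists x.
exists (M + 1) => _ [y Xy <-].
by apply: (MP (M + 1)); [rewrite ltrDl | exists y].
Qed.

Lemma ri_sub A : ri A `<=` A.
Proof. by move=> q [hull_q [e e0]]; apply=> // m; rewrite subrr normr0. Qed.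

(** The step [t] has to keep every coefficient of [t *: (q - p)] below the
    radius [e] of a ball around [q]; the sum of the finitely many nonzero
    coefficients of [q - p] bounds each of them. *)
Lemma ri_prolong A p q : ri A q -> A p ->
  exists2 t : R, 0 < t & A (q + t *: (q - p)).
Proof.
move=> riq Ap; have Aq := ri_sub _ _ riq; case: riq => [_ [e e0 ball_q]].
set h := q - p; pose B : R := \sum_(m <- msupp h) `|mcoeff m h|.
have B0 : 0 <= B by apply: sumr_ge0.
have hB m : `|mcoeff m h| <= B.
  have [mh|/memN_msupp_eq0 ->] := boolP (m \in msupp h); last by rewrite normr0.
  by rewrite /B (bigD1_seq m)//= lerDl sumr_ge0.
have B1 : 0 < B + 1 by rewrite ltr_wpDl.
have t0 : 0 < e / (B + 1) by rewrite divr_gt0.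
exists (e / (B + 1)) => //; apply: ball_q; first exact: aff_hull_line.
move=> m; rewrite mcoeffD addrC addKr mcoeffZ normrM (gtr0_norm t0).
rewrite mulrAC ltr_pdivrMr// ltr_pM2l//.
by apply: le_lt_trans (hB m) _; rewrite ltrDl.
Qed.

Lemma argmin_deviation X f V p q : argmin_dev X f V p -> argmin_dev X f V q ->
  deviation X f p = deviation X f q.
Proof. by move=> [Vp pmin] [Vq qmin]; apply/eqP; rewrite eq_le pmin ?qmin. Qed.

Section CompactDomain.
Variables (X : set 'rV[R]_n) (f : 'rV[R]_n -> R) (V : set (mpoly n R)).
Hypotheses (cX : compact X) (cf : {within X, continuous f}).

(** Where [f - p] attains its bound, [f - q] cannot be larger, so [p - q <= 0]
    there; with the opposite sign where [p - f] attains it. *)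
Lemma argmin_sub_Sset p q : V (p - q) ->
  argmin_dev X f V p -> argmin_dev X f V q -> Sset X f V p (p - q).
Proof.
move=> Vpq Qp Qq; split=> // x y [Xx px] [Xy py].
have := le_deviation X f q x cX cf Xx; have := le_deviation X f q y cX cf Xy.
rewrite -(argmin_deviation _ _ _ _ _ Qp Qq) !ler_norml => /andP[qy _] /andP[_ qx].
rewrite /peval !mevalB -!/(peval _ _); apply: mulr_le0_ge0; lra.
Qed.

(** With [r = q + t (q - p)] of the same deviation [d], the error of [q] is the
    mean of the errors of [r] and [p] with weights [1] and [t]; when it reaches
    [d], resp. [-d], so does the error of [p]. *)
Lemma Sset_sub_ri p q : ri (argmin_dev X f V) q -> argmin_dev X f V p ->
  Sset X f V p `<=` Sset X f V q.
Proof.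
move=> riq Qp; have [t t0 Qr] := ri_prolong _ _ _ riq Qp.
have Qq := ri_sub _ _ riq.
set r := q + _ in Qr.
have dqp := argmin_deviation _ _ _ _ _ Qq Qp.
have drp := argmin_deviation _ _ _ _ _ Qr Qp.
have rE x : peval r x = peval q x + t * (peval q x - peval p x).
  by rewrite /peval mevalD mevalZ mevalB.
move=> s [Vs sep]; split=> // x y [Xx qx] [Xy qy]; apply: sep; split=> //.
- have := le_deviation X f p x cX cf Xx; have := le_deviation X f r x cX cf Xx.
  rewrite drp !ler_norml rE => /andP[_ rx] /andP[_ px].
  apply/eqP; rewrite eq_le px /= -(ler_pM2l t0); nra.
- have := le_deviation X f p y cX cf Xy; have := le_deviation X f r y cX cf Xy.
  rewrite drp !ler_norml rE => /andP[ry _] /andP[py _].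
  apply/eqP; rewrite eq_le -(ler_pM2l t0); apply/andP; split; nra.
Qed.

End CompactDomain.

End Approximation.

Theorem lemma10 (R : realType) (n : nat) (X : set 'rV[R]_n)
    (f : 'rV[R]_n -> R) (k : nat) (g : 'I_k -> mpoly n R)
    (V Q : set (mpoly n R)) :
  compact X ->
  {within X, continuous f} ->
  lin_indep g ->
  V = lin_span g ->
  Q = argmin_dev X f V ->
  forall (S : set (mpoly n R)),
    (exists2 q0, ri Q q0 & S = Sset X f V q0) ->
    (aff_dim Q <= aff_dim S)%N /\
    forall q p, Q q -> Q p ->
      Sset X f V p (p - q) /\ Sset X f V p `<=` S.
Proof.
move=> cX cf _ VE -> S [q0 riq0 ->].
have sub_Sset p q : argmin_dev X f V p -> argmin_dev X f V q ->
    Sset X f V p (p - q).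
  move=> Qp Qq; apply: argmin_sub_Sset => //.
  by case: Qp Qq => Vp _ [Vq _]; rewrite VE in Vp Vq *; apply: lin_spanB.
have Qq0 := ri_sub _ _ riq0.
split; last by move=> q p Qq Qp; split; [exact: sub_Sset | exact: Sset_sub_ri].
apply: (aff_dim_le g); first by rewrite -VE => s [].
by apply: aff_direction_reflect => q; apply: sub_Sset.
Qed.
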